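(* Let $\mu_1\in\mathbb{R}$, $\sigma_1>0$, $\sigma>0$ and $k>0$. Consider two stocks with positive prices $p_{1t},p_{2t}$ at discrete times $t$, such that $$\log(p_{1,t+1})=\log(p_{1t})+\mu_1+\delta_{1,t+1},\qquad \epsilon_t:=\log(p_{2t})-\log(p_{1t}),$$ where the $\delta_{1t}$ are i.i.d. $N(0,\sigma_1^2)$, the $\epsilon_t$ are i.i.d. $N(0,\sigma^2)$, and the family $(\delta_{1t})_t$ is independent of the family $(\epsilon_t)_t$. Define the stock returns $r_{i,t+1}=p_{i,t+1}/p_{it}-1$ for $i=1,2$, the trading signal $$S_t=\mathbb{1}\{\epsilon_t\le -k\sigma\}-\mathbb{1}\{\epsilon_t\ge k\sigma\},$$ and the pair return $r_{t+1}=S_t\,(r_{2,t+1}-r_{1,t+1})$. Let $Z$ be a standard normal random variable. Then the pair return $r_t$ has mean $$\mathbf{E}[r_t]=e^{\mu_1+\sigma_1^2/2+\sigma^2}\,\mathbf{P}(k-\sigma\le Z\le k+\sigma)$$ and variance $$\operatorname{Var}(r_t)=e^{2\mu_1+2\sigma_1^2+4\sigma^2}\big(\mathbf{P}(Z\le -k+2\sigma)+\mathbf{P}(Z\ge k+2\sigma)\big)-2e^{2\mu_1+2\sigma_1^2+\sigma^2}\big(\mathbf{P}(Z\le -k+\sigma)+\mathbf{P}(Z\ge k+\sigma)\big)+2e^{2\mu_1+2\sigma_1^2}\,\mathbf{P}(Z\ge k)-\mathbf{E}[r_t]^2.$$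
   Context: This models a ''cointegrated pair'' of stocks: stock 1's log-price is a Gaussian random walk with drift, and the log-price difference (the spread) $\epsilon_t$ is i.i.d. Gaussian. The signal is $+1$ when the spread is at most $-k\sigma$, $-1$ when it is at least $k\sigma$, and $0$ otherwise. *)

(* Defs.v *)
From HB Require Import structures.
From mathcomp Require Import all_boot all_order all_algebra finmap.
From mathcomp Require Import all_classical all_reals all_analysis.
Set Implicit Arguments. Unset Strict Implicit. Unset Printing Implicit Defensive.
Import Order.TTheory GRing.Theory Num.Theory.
Local Open Scope classical_set_scope.
Local Open Scope ring_scope.

Section defs.
Context {d : measure_display} {T : measurableType d} {R : realType}.

Definition mutually_independent (P : probability T R) (I : choiceType)
    (X : I -> T -> R) : Prop :=
  forall (J : {fset I}) (B : I -> set R),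
    (forall i, i \in J -> measurable (B i)) ->
    P (\bigcap_(i in [set` J]) (X i @^-1` B i)) =
    (\prod_(i <- J) P (X i @^-1` B i))%E.

(* Independence of the family X from the family Y (i.e. of the sigma-algebras
   they generate), stated on the generating pi-system of finite cylinders. *)
Definition independent_families (P : probability T R) (I J : choiceType)
    (X : I -> T -> R) (Y : J -> T -> R) : Prop :=
  forall (I0 : {fset I}) (J0 : {fset J}) (A : I -> set R) (B : J -> set R),
    (forall i, i \in I0 -> measurable (A i)) ->
    (forall j, j \in J0 -> measurable (B j)) ->
    P (\bigcap_(i in [set` I0]) (X i @^-1` A i) `&`
       \bigcap_(j in [set` J0]) (Y j @^-1` B j)) =
    (P (\bigcap_(i in [set` I0]) (X i @^-1` A i)) *
     P (\bigcap_(j in [set` J0]) (Y j @^-1` B j)))%E.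

(* X has the normal distribution N(m, s^2) (s = standard deviation). *)
Definition has_normal_law (P : probability T R) (X : T -> R) (m s : R) : Prop :=
  forall A : set R, measurable A -> P (X @^-1` A) = normal_prob m s A.

Definition simple_return (p : nat -> T -> R) (t : nat) (w : T) : R :=
  p t.+1 w / p t w - 1.

Definition signal (eps : nat -> T -> R) (k sigma : R) (t : nat) (w : T) : R :=
  (if eps t w <= - (k * sigma) then 1 else 0) -
  (if k * sigma <= eps t w then 1 else 0).

Definition pair_return (p1 p2 : nat -> T -> R) (eps : nat -> T -> R)
    (k sigma : R) (t : nat) (w : T) : R :=
  signal eps k sigma t w * (simple_return p2 t w - simple_return p1 t w).

End defs.

Definition stdnormP {R : realType} (A : set R) : R := fine (normal_prob 0 1 A).

(* Main.v *)
(* With delta = delta_{t+1}, e = eps_t and e' = eps_{t+1}, the pair return is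
   S(e) * exp(mu1 + delta) * (exp(e' - e) - 1), so it and its square are linear
   combinations of products exp(a delta) * (1_D(e) exp(b e)) * exp(c e') where
   D is one of the two tails {e <= -k sigma}, {e >= k sigma}. The three
   variables are independent, so Tonelli factorises the expectation of such a
   product, and completing the square, i.e.
     exp(b x) N(0, s^2)(dx) = exp(b^2 s^2 / 2) N(b s^2, s^2)(dx),
   turns each factor into a standard normal tail. *)
Require Import Defs.
From HB Require Import structures.
From mathcomp Require Import all_boot all_order all_algebra finmap.
From mathcomp Require Import all_classical all_reals all_analysis measurable_realfun ring lra.
Import Order.TTheory GRing.Theory Num.Theory.
Local Open Scope classical_set_scope.
Local Open Scope ring_scope.
Import numFieldNormedType.Exports.
Set Implicit Arguments.
Unset Strict Implicit.
Unset Printing Implicit Defensive.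

(** * Exponential moments of a centred Gaussian, on the line and on tails *)

Section normal_integrals.
Context {R : realType}.
Local Notation mu := (@lebesgue_measure R).
Implicit Types (m s a b : R) (E : set R).

(** [normal_pdf m s] and the Radon-Nikodym derivative of [normal_prob m s] have the same Lebesgue
    integral on every measurable set, hence agree almost everywhere; the change of variables for the
    derivative then passes to the density. *)
Lemma ge0_integral_normal_prob m s E (f : R -> \bar R) :
  measurable E -> measurable_fun E f -> (forall x, 0 <= f x)%E ->
  (\int[normal_prob m s]_(x in E) f x =
   \int[mu]_(x in E) (f x * (normal_pdf m s x)%:E))%E.
Proof.
move=> mE mf f0.
have dom := @normal_prob_dominates R m s.
rewrite -(Radon_Nikodym_SigmaFinite.change_of_variables dom f0 mE mf).
have mpdf : measurable_fun setT (fun x => (normal_pdf m s x)%:E).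
  by apply/measurable_EFinP; exact: measurable_normal_pdf.
have iRN := Radon_Nikodym_SigmaFinite.f_integrable dom.
apply: ae_eq_integral => //.
- apply: emeasurable_funM => //; apply: measurable_funTS.
  exact: measurable_int iRN.
- by apply: emeasurable_funM => //; apply: measurable_funTS.
apply: ae_eqe_mul2l; apply: (@ae_eq_subset _ _ _ _ mu setT E) => //.
apply: integral_ae_eq => // A _ mA.
by rewrite -Radon_Nikodym_SigmaFinite.f_integral.
Qed.

Lemma normal_pdf_tilt s b x : s != 0 ->
  expR (b * x) * normal_pdf 0 s x =
  expR (b ^+ 2 * s ^+ 2 / 2) * normal_pdf (b * s ^+ 2) s x.
Proof.
move=> s0; rewrite !normal_pdfE// /normal_fun mulrCA [RHS]mulrCA.
by congr (_ * _); rewrite -!expRD; congr expR; field.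
Qed.

Lemma normal_pdf_standardize m s x : 0 < s ->
  normal_pdf m s x = normal_pdf 0 1 ((x - m) / s) / s.
Proof.
move=> s0; rewrite !normal_pdfE ?gt_eqF// mulrAC /normal_peak.
congr (_ * _); last by rewrite /normal_fun; congr expR; field; rewrite gt_eqF.
(* The Jacobian [1 / s] comes out of the normalising constant, as sqrt(s^2 c) = s sqrt(c). *)
rewrite -!mulrnAr sqrtrM ?sqr_ge0// sqrtr_sqr gtr0_norm// expr1n mul1r.
by rewrite invfM mulrC.
Qed.

Lemma integral_normal_probT_expR s b : 0 < s ->
  (\int[normal_prob 0 s]_x (expR (b * x))%:E =
   (expR (b ^+ 2 * s ^+ 2 / 2))%:E)%E.
Proof.
move=> s0; rewrite ge0_integral_normal_prob//; last first.
  by apply/measurable_EFinP; apply: measurableT_comp => //; exact: measurable_funM.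
under eq_integral do rewrite -EFinM normal_pdf_tilt ?gt_eqF// EFinM.
rewrite integralZl//=; last exact: integrable_normal_pdf.
by rewrite integral_normal_pdf mule1.
Qed.

Lemma normal_prob_tail_standardize m s a : 0 < s ->
  normal_prob m s `[a, +oo[ = normal_prob 0 1 `[(a - m) / s, +oo[.
Proof.
move=> s0; rewrite /normal_prob.
pose F (x : R) := (x - m) / s.
have F'E : F^`()%classic = cst s^-1.
  apply/funext => x; rewrite /F derive1E deriveM// deriveD// derive_cst scaler0.
  by rewrite add0r derive_id derive_cst addr0 scaler1.
(* [F] is affine with constant slope [1 / s > 0]; after the first goal, the rest are the side
   conditions of the substitution. *)
rewrite (@increasing_ge0_integration_by_substitutiony R F (normal_pdf 0 1) a).
- by apply: eq_integral => x _; rewrite /= F'E normal_pdf_standardize.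
- by move=> x y _ _ xy; rewrite /F ltr_pM2r ?invr_gt0// ltrD2r.
- by rewrite F'E => x _; exact: cst_continuous.
- by rewrite F'E; exact: is_cvg_cst.
- by rewrite F'E; exact: is_cvg_cst.
- split; first by move=> x _; apply: derivableM.
  apply: cvg_at_right_filter.
  by apply: cvgM; [apply: cvgB; [exact: cvg_id|exact: cvg_cst]|exact: cvg_cst].
- by apply/gt0_cvgMly; [rewrite invr_gt0|exact: cvg_addrr].
- apply/continuous_subspaceT => x; apply: continuous_normal_pdf; exact: oner_neq0.
- by move=> x _; exact: normal_pdf_ge0.
Qed.

Lemma integral_normal_prob_expR_tail s a b : 0 < s ->
  (\int[normal_prob 0 s]_(x in `[a, +oo[) (expR (b * x))%:E =
   (expR (b ^+ 2 * s ^+ 2 / 2))%:E * normal_prob 0 1 `[(a / s - b * s)%R, +oo[)%E.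
Proof.
move=> s0; rewrite ge0_integral_normal_prob//; last first.
  apply/measurable_EFinP; apply: measurable_funTS.
  by apply: measurableT_comp => //; exact: measurable_funM.
under eq_integral do rewrite -EFinM normal_pdf_tilt ?gt_eqF// EFinM.
rewrite integralZl//=; last first.
  by apply: (integrableS measurableT) => //; exact: integrable_normal_pdf.
(* What remains is the integral of the tilted density, by definition a tail mass of N(b s^2,
   s^2). *)
rewrite -[X in (_ * X)%E]/(normal_prob (b * s ^+ 2) s _).
rewrite normal_prob_tail_standardize//.
by have -> : (a - b * s ^+ 2) / s = a / s - b * s by field; rewrite gt_eqF.
Qed.

(** Reflection x -> -x: the centred density is even, so only the sign of [b] changes. *)
Lemma integral_normal_prob_expR_lower_tail s a b : 0 < s ->
  (\int[normal_prob 0 s]_(x in `]-oo, (- a)%R]) (expR (b * x))%:E =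
   \int[normal_prob 0 s]_(x in `[a, +oo[) (expR (- b * x))%:E)%E.
Proof.
move=> s0; have mexp c E : measurable E ->
    measurable_fun E (fun x : R => (expR (c * x))%:E).
  move=> mE; apply/measurable_EFinP; apply: measurable_funTS.
  by apply: measurableT_comp => //; exact: measurable_funM.
rewrite !ge0_integral_normal_prob//; [|exact: mexp..].
under eq_integral do rewrite -EFinM.
rewrite (@ge0_integration_by_substitutionNy R
  (fun x => expR (b * x) * normal_pdf 0 s x)).
- apply: eq_integral => x _ /=; rewrite -EFinM mulrN mulNr.
  by rewrite !normal_pdfE ?gt_eqF// /normal_fun !subr0 sqrrN.
- apply/continuous_subspaceT => x; apply: cvgM; last first.
    by apply: continuous_normal_pdf; rewrite gt_eqF.
  apply: (cvg_comp _ expR); last exact: continuous_expR.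
  by apply: cvgM; [exact: cvg_cst|exact: cvg_id].
- by move=> x _; rewrite mulr_ge0 ?expR_ge0// normal_pdf_ge0.
Qed.

End normal_integrals.

(** * Joint law of two variables from its values on rectangles *)

Section law_of_pair.
Context d d1 d2 (T : measurableType d) (T1 : measurableType d1)
  (T2 : measurableType d2) (R : realType).
Local Open Scope ereal_scope.

(** This is uniqueness of the product measure, applied to the pushforward of [Q]. [Q] is a general
    measure so that it can also be a rescaled restriction of a probability. *)
Lemma measure_preimage_pair (Q : {measure set T -> \bar R})
    (m1 : {sigma_finite_measure set T1 -> \bar R})
    (m2 : {sigma_finite_measure set T2 -> \bar R}) (X : T -> T1) (Y : T -> T2)
    (D : set (T1 * T2)) :
  measurable_fun setT X -> measurable_fun setT Y ->
  (forall A B, measurable A -> measurable B ->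
    Q (X @^-1` A `&` Y @^-1` B) = m1 A * m2 B) ->
  measurable D -> Q ((fun w => (X w, Y w)) @^-1` D) = (m1 \x m2) D.
Proof.
move=> mX mY QXY mD.
pose Z : {mfun T >-> (T1 * T2)%type} := mfun_Sub (mem_set (measurable_fun_pair mX mY)).
by rewrite (@product_measure_unique _ _ _ _ _ m1 m2
  (pushforward Q Z : {measure set _ -> \bar R})).
Qed.

End law_of_pair.

(** * Joint law of three independent variables and factorisation of integrals *)

Section law_of_triple.
Context d d1 d2 d3 (T : measurableType d) (T1 : measurableType d1)
  (T2 : measurableType d2) (T3 : measurableType d3) (R : realType).
Local Open Scope ereal_scope.

(** The pair case is used twice: once for (X, Y) against [W], which leaves sets of the form D' x C,
    and once for [X] against [Y] with [C] fixed. *)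
Lemma measure_preimage_triple (P : probability T R)
    (m1 : probability T1 R) (m2 : probability T2 R) (m3 : probability T3 R)
    (X : T -> T1) (Y : T -> T2) (W : T -> T3) (D : set (T1 * T2 * T3)) :
  measurable_fun setT X -> measurable_fun setT Y -> measurable_fun setT W ->
  (forall A B C, measurable A -> measurable B -> measurable C ->
    P (X @^-1` A `&` (Y @^-1` B `&` W @^-1` C)) = m1 A * (m2 B * m3 C)) ->
  measurable D ->
  P ((fun w => ((X w, Y w), W w)) @^-1` D) = ((m1 \x m2) \x m3) D.
Proof.
move=> mX mY mW PXYW.
pose m12 : probability (T1 * T2)%type R := (m1 \x m2)%E.
apply: (@measure_preimage_pair _ _ _ _ _ _ _ P m12 m3) => //; first exact: measurable_fun_pair.
move=> D' C mD' mC; rewrite {}/m12 /=.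
have mWC : measurable (W @^-1` C) by rewrite -[_ @^-1` _]setTI; exact: mW.
have mXY : measurable ((fun w => (X w, Y w)) @^-1` D').
  by rewrite -[_ @^-1` _]setTI; exact: measurable_fun_pair.
have PWC : P (W @^-1` C) = m3 C.
  have := PXYW _ _ _ measurableT measurableT mC.
  by rewrite !preimage_setT !setTI !probability_setT !mul1e.
(* For C of nonzero mass, condition P on W \in C: X and Y still have the
   product law, which extends from rectangles to D'. *)
have [C0|C0] := eqVneq (m3 C) 0.
  rewrite C0 mule0; apply/eqP; rewrite -measure_le0 -C0 -PWC.
  by apply: le_measure; rewrite ?inE//; exact: measurableI.
have c0 : (0 <= (fine (m3 C))^-1)%R by rewrite invr_ge0 fine_ge0.
have cC : ((fine (m3 C))^-1)%:E * m3 C = 1.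
  rewrite -[X in _ * X]fineK ?fin_num_measure// -EFinM mulVf//.
  by rewrite fine_eq0// fin_num_measure.
rewrite -(@measure_preimage_pair _ _ _ _ _ _ _
  (mscale (NngNum c0) (mrestr P mWC)) m1 m2 X Y)//=; last first.
  move=> A B mA mB; rewrite /mscale/= /mrestr -setIA PXYW// muleCA.
  by rewrite [X in _ * X = _]muleCA cC mule1.
by rewrite /mscale/= /mrestr muleC muleA (muleC (m3 C)) cC mul1e.
Qed.

Lemma ge0_integral_triple (P : probability T R)
    (m1 : probability T1 R) (m2 : probability T2 R) (m3 : probability T3 R)
    (X : T -> T1) (Y : T -> T2) (W : T -> T3) (f : T1 -> \bar R)
    (g : T2 -> \bar R) (h : T3 -> \bar R) :
  measurable_fun setT X -> measurable_fun setT Y -> measurable_fun setT W ->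
  (forall A B C, measurable A -> measurable B -> measurable C ->
    P (X @^-1` A `&` (Y @^-1` B `&` W @^-1` C)) = m1 A * (m2 B * m3 C)) ->
  measurable_fun setT f -> measurable_fun setT g -> measurable_fun setT h ->
  (forall x, 0 <= f x) -> (forall y, 0 <= g y) -> (forall z, 0 <= h z) ->
  \int[P]_w (f (X w) * g (Y w) * h (W w)) =
  \int[m1]_x f x * \int[m2]_y g y * \int[m3]_z h z.
Proof.
move=> mX mY mW PXYW mf mg mh f0 g0 h0.
pose m12 : probability (T1 * T2)%type R := (m1 \x m2)%E.
pose G (p : T1 * T2) := f p.1 * g p.2.
pose F (p : T1 * T2 * T3) := G p.1 * h p.2.
pose Z w := ((X w, Y w), W w).
have mZ : measurable_fun setT Z.
  by apply: measurable_fun_pair => //; exact: measurable_fun_pair.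
have mG : measurable_fun setT G.
  by apply: emeasurable_funM; apply: measurableT_comp.
have mF : measurable_fun setT F.
  by apply: emeasurable_funM; apply: measurableT_comp.
have G0 p : 0 <= G p by rewrite mule_ge0.
have F0 p : 0 <= F p by rewrite mule_ge0.
rewrite -[LHS]/(\int[P]_(w in Z @^-1` setT) (F \o Z) w).
rewrite -ge0_integral_pushforward//.
rewrite (eq_measure_integral (m12 \x m3)); last first.
  by move=> A mA _; exact: (@measure_preimage_triple _ _ _ _ _ _ _ _ mX mY mW PXYW).
(* Tonelli first integrates out the third coordinate, and below the second one. *)
rewrite fubini_tonelli1//.
transitivity (\int[m12]_p (G p * \int[m3]_z h z)).
  apply: eq_integral => p _; rewrite /fubini_F /F/= ge0_integralZl//.
rewrite ge0_integralZr//; last exact: integral_ge0.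
congr (_ * _); rewrite fubini_tonelli1//.
transitivity (\int[m1]_x (f x * \int[m2]_z g z)).
  apply: eq_integral => x _; rewrite /fubini_F /G/= ge0_integralZl//.
by rewrite ge0_integralZr//; exact: integral_ge0.
Qed.

End law_of_triple.

(** * Calculus of expectations and the Gaussian product moment *)

Section gaussian_factors.
Context d (T : measurableType d) (R : realType).
Variable P : probability T R.
Implicit Types (X Y W : T -> R) (D : set R) (x y k s a b c : R).

(** Integrability travels with the value, since linearity of the expectation requires it at each
    step. *)
Definition has_expectation X x := X \in Lfun P 1 /\ 'E_P[X]%E = x%:E.

Lemma has_expectationD X Y x y : has_expectation X x -> has_expectation Y y ->
  has_expectation (fun w => X w + Y w) (x + y).
Proof.
move=> [X1 EX] [Y1 EY]; split.
  by rewrite -[fun _ => _]/(X \+ Y)%R; exact: rpredD.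
by rewrite -[fun _ => _]/(X \+ Y)%R expectationD// EX EY EFinD.
Qed.

Lemma has_expectationZ k X x : has_expectation X x ->
  has_expectation (fun w => k * X w) (k * x).
Proof.
move=> [X1 EX]; have -> : (fun w => k * X w) = (k \o* X)%R.
  by apply/funext => w /=; rewrite mulrC.
by split; [exact: Lfun_scale|rewrite expectationZl// EX EFinM].
Qed.

Lemma has_expectation_variance X x y : has_expectation X x ->
  has_expectation (fun w => X w * X w) y -> variance P X = (y - x ^+ 2)%:E.
Proof.
move=> [X1 EX] [XX1 EXX]; rewrite /variance covarianceE//.
by rewrite [X in (X - _)%E]EXX EX -EFinM -EFinB expr2.
Qed.

(** [y] stands for the standard normal tail produced by the tilt on [D]; leaving it abstract lets
    one lemma serve both tails. The three Gaussian exponents add up to the one displayed. *)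
Lemma has_expectation_gaussian_factors X Y W (s1 : R) s D a b c y : 0 < s1 -> 0 < s ->
  measurable_fun setT X -> measurable_fun setT Y -> measurable_fun setT W ->
  (forall A B C, measurable A -> measurable B -> measurable C ->
    (P (X @^-1` A `&` (Y @^-1` B `&` W @^-1` C)) =
     normal_prob 0 s1 A * (normal_prob 0 s B * normal_prob 0 s C))%E) ->
  measurable D ->
  (\int[normal_prob 0 s]_(x in D) (expR (b * x))%:E =
   (expR (b ^+ 2 * s ^+ 2 / 2) * y)%:E)%E ->
  has_expectation
    (fun w => expR (a * X w) * (\1_D (Y w) * expR (b * Y w)) * expR (c * W w))
    (expR ((a ^+ 2 * s1 ^+ 2 + (b ^+ 2 + c ^+ 2) * s ^+ 2) / 2) * y).
Proof.
move=> s1_gt0 s_gt0 mX mY mW PXYW mD yE.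
have mexp k : measurable_fun setT (fun x : R => expR (k * x)).
  by apply: measurableT_comp => //; exact: measurable_funM.
have mD1 : measurable_fun setT (fun x : R => \1_D x * expR (b * x)).
  by apply: measurable_funM => //; exact: measurable_indic.
have mXYW : measurable_fun setT (fun w =>
    expR (a * X w) * (\1_D (Y w) * expR (b * Y w)) * expR (c * W w)).
  apply: measurable_funM; last exact: (measurableT_comp (mexp c) mW).
  apply: measurable_funM; first exact: (measurableT_comp (mexp a) mX).
  exact: (measurableT_comp mD1 mY).
have E : (\int[P]_w
    (expR (a * X w) * (\1_D (Y w) * expR (b * Y w)) * expR (c * W w))%:E =
    (expR ((a ^+ 2 * s1 ^+ 2 + (b ^+ 2 + c ^+ 2) * s ^+ 2) / 2) * y)%:E)%E.
  under eq_integral do rewrite 2!EFinM.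
  have mE (f : R -> R) : measurable_fun setT f ->
      measurable_fun setT (fun x => (f x)%:E) by move=> mf; apply/measurable_EFinP.
  rewrite (@ge0_integral_triple _ _ _ _ _ _ _ _ _ P (normal_prob 0 s1)
    (normal_prob 0 s) (normal_prob 0 s) X Y W _ _ _ mX mY mW PXYW
    (mE _ (mexp a)) (mE _ mD1) (mE _ (mexp c)))//.
  rewrite !integral_normal_probT_expR//.
  have -> : (\int[normal_prob 0 s]_x (\1_D x * expR (b * x))%:E =
      \int[normal_prob 0 s]_(x in D) (expR (b * x))%:E)%E.
    rewrite [RHS]integral_mkcond; apply: eq_integral => x _.
    by rewrite patchE indicE; case: ifPn => _; rewrite ?mul1r ?mul0r.
  rewrite yE -!EFinM; congr EFin.
  rewrite mulrAC mulrA -!expRD.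
  by congr (expR _ * _); field.
split; last by rewrite unlock.
(* The function is nonnegative, so the finite value [E] of its integral already gives
   integrability. *)
apply/Lfun1_integrable/integrableP; split; first by apply/measurable_EFinP.
under eq_integral do rewrite /= ger0_norm ?mulr_ge0//.
by rewrite E ltry.
Qed.

End gaussian_factors.

(** * Symmetry and differences of standard normal tails *)

Section standard_normal_tails.
Context {R : realType}.
Implicit Types x y s a b : R.

Lemma stdnormP_EFin (E : set R) : measurable E ->
  (stdnormP E)%:E = normal_prob 0 1 E.
Proof. by move=> mE; rewrite /stdnormP fineK// fin_num_measure. Qed.

Lemma stdnormP_lower_tail x : stdnormP `]-oo, (- x)] = stdnormP `[x, +oo[.
Proof.
(* With exponent 0 the integrands are 1, and the reflection formula becomes the symmetry of the
   law. *)
have := @integral_normal_prob_expR_lower_tail R 1 x 0 ltr01.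
under eq_integral do rewrite mul0r expR0.
under [RHS]eq_integral do rewrite oppr0 mul0r expR0.
by rewrite !integral_cst// !mul1e => E; rewrite /stdnormP; congr fine.
Qed.

Lemma stdnormP_itv x y : x <= y ->
  stdnormP `[x, y] = stdnormP `[x, +oo[ - stdnormP `[y, +oo[.
Proof.
move=> xy; apply: EFin_inj; rewrite EFinB !stdnormP_EFin//.
(* The point [y] is null, so the closed tail may be opened to make the union below disjoint. *)
have -> : normal_prob 0 1 `[y, +oo[ = normal_prob 0 1 `]y, +oo[.
  rewrite /normal_prob integral_itv_obnd_cbnd//.
  by apply/measurable_funTS/measurable_EFinP; exact: measurable_normal_pdf.
have -> : `[x, +oo[%classic = `[x, y] `|` `]y, +oo[.
  by rewrite -itv_bndbnd_setU.
rewrite measureU//; first by rewrite addeK// fin_num_measure.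
apply/seteqP; split => z //=; rewrite !in_itv/= andbT => -[/andP[_ zy]].
by rewrite ltNge zy.
Qed.

End standard_normal_tails.

(** * Mean and variance of the pair return *)

Theorem theorem1 (d : measure_display) (T : measurableType d) (R : realType)
  (P : probability T R) (mu1 sigma1 sigma k : R)
  (delta eps : nat -> T -> R) (p1 p2 : nat -> T -> R) :
  0 < sigma1 -> 0 < sigma -> 0 < k ->
  (forall t, measurable_fun setT (delta t)) ->
  (forall t, measurable_fun setT (eps t)) ->
  (forall t, has_normal_law P (delta t) 0 sigma1) ->
  (forall t, has_normal_law P (eps t) 0 sigma) ->
  mutually_independent P delta ->
  mutually_independent P eps ->
  independent_families P delta eps ->
  (forall t w, 0 < p1 t w) -> (forall t w, 0 < p2 t w) ->
  (forall t w, ln (p1 t.+1 w) = ln (p1 t w) + mu1 + delta t.+1 w) ->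
  (forall t w, eps t w = ln (p2 t w) - ln (p1 t w)) ->
  forall t : nat,
    let r := pair_return p1 p2 eps k sigma t in
    let m := expR (mu1 + sigma1 ^+ 2 / 2 + sigma ^+ 2) *
             stdnormP `[k - sigma, k + sigma] in
    ('E_P[r])%E = m%:E /\
    variance P r =
      (expR (mu1 *+ 2 + sigma1 ^+ 2 *+ 2 + sigma ^+ 2 *+ 4) *
         (stdnormP `]-oo, - k + sigma *+ 2] + stdnormP `[k + sigma *+ 2, +oo[)
       - 2 * expR (mu1 *+ 2 + sigma1 ^+ 2 *+ 2 + sigma ^+ 2) *
         (stdnormP `]-oo, - k + sigma] + stdnormP `[k + sigma, +oo[)
       + 2 * expR (mu1 *+ 2 + sigma1 ^+ 2 *+ 2) * stdnormP `[k, +oo[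
       - m ^+ 2)%:E.
Proof.
move=> s1_gt0 s_gt0 k_gt0 mdelta meps delta_law eps_law _ indep_eps indep.
move=> p1_gt0 p2_gt0 dp1 epsE t r m.
(* The three variables have a product law: independence of the families separates [delta] from
   [eps], and mutual independence of [eps] separates times t and t+1. *)
have law (A B C : set R) : measurable A -> measurable B -> measurable C ->
    (P (delta t.+1 @^-1` A `&` (eps t @^-1` B `&` eps t.+1 @^-1` C)) =
     normal_prob 0 sigma1 A * (normal_prob 0 sigma B * normal_prob 0 sigma C))%E.
  move=> mA mB mC.
  pose BC i := if i == t then B else C.
  have mBC i : i \in [fset t; t.+1]%fset -> measurable (BC i).
    by rewrite /BC; case: ifP.
  have cap2 : \bigcap_(i in [set` [fset t; t.+1]%fset]) (eps i @^-1` BC i) =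
      eps t @^-1` B `&` eps t.+1 @^-1` C.
    rewrite set_fsetU !set_fset1 bigcap_setU !bigcap_set1 /BC eqxx.
    by rewrite (gtn_eqF (ltnSn t)).
  have cap1 : \bigcap_(i in [set` [fset t.+1]%fset]) (delta i @^-1` A) =
      delta t.+1 @^-1` A.
    by rewrite set_fset1 bigcap_set1.
  have := indep [fset t.+1]%fset [fset t; t.+1]%fset (fun=> A) BC
    (fun _ _ => mA) mBC.
  rewrite cap1 cap2 => ->; rewrite delta_law//; congr (_ * _)%E.
  have := indep_eps [fset t; t.+1]%fset BC mBC; rewrite cap2 => ->.
  rewrite big_fsetU1/= ?inE ?(ltn_eqF (ltnSn t))// big_seq_fset1 /BC eqxx.
  by rewrite (gtn_eqF (ltnSn t)) !eps_law.
pose L : set R := `]-oo, (- (k * sigma))%R]%classic.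
pose U : set R := `[(k * sigma)%R, +oo[%classic.
pose Q (x : R) := stdnormP `[x, +oo[.
pose V (D : set R) (a b c : R) w :=
  expR (a * delta t.+1 w) * (\1_D (eps t w) * expR (b * eps t w)) *
  expR (c * eps t.+1 w).
(* The threshold [k * sigma] standardises to [k], and the tilt moves it to [k - b * sigma]; for [L]
   below, the reflection turns [b] into [- b]. *)
have EU a b c : has_expectation P (V U a b c) (expR ((a ^+ 2 * sigma1 ^+ 2 +
    (b ^+ 2 + c ^+ 2) * sigma ^+ 2) / 2) * Q (k - b * sigma)).
  apply: has_expectation_gaussian_factors => //; rewrite ?/U ?/L /Q//.
  rewrite integral_normal_prob_expR_tail// EFinM stdnormP_EFin//.
  by rewrite mulfK// gt_eqF.
have EL a b c : has_expectation P (V L a b c) (expR ((a ^+ 2 * sigma1 ^+ 2 +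
    (b ^+ 2 + c ^+ 2) * sigma ^+ 2) / 2) * Q (k + b * sigma)).
  apply: has_expectation_gaussian_factors => //; rewrite ?/U ?/L /Q//.
  rewrite integral_normal_prob_expR_lower_tail//.
  rewrite integral_normal_prob_expR_tail// EFinM stdnormP_EFin//.
  by rewrite sqrrN mulNr opprK mulfK// gt_eqF.
(* Both gross returns share the factor exp(mu1 + delta), and the two -1 of the simple returns
   cancel. *)
have rE w : r w = ((if eps t w <= - (k * sigma) then 1 else 0) -
    (if k * sigma <= eps t w then 1 else 0)) * (expR mu1 *
    (expR (delta t.+1 w) * (expR (- eps t w) * expR (eps t.+1 w) - 1))).
  rewrite /r /pair_return /signal /simple_return; congr (_ * _).
  have -> : p1 t.+1 w / p1 t w = expR (mu1 + delta t.+1 w).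
    rewrite -(lnK (p1_gt0 t.+1 w)) -(lnK (p1_gt0 t w)) -expRB dp1.
    by congr expR; ring.
  have -> : p2 t.+1 w / p2 t w =
      expR (mu1 + delta t.+1 w + eps t.+1 w - eps t w).
    rewrite -(lnK (p2_gt0 t.+1 w)) -(lnK (p2_gt0 t w)) -expRB !epsE dp1.
    by congr expR; ring.
  by rewrite !expRD; ring.
have ks_gt0 : 0 < k * sigma by rewrite mulr_gt0.
have exp2 x : expR (2 * x) = expR x ^+ 2 :> R.
  by rewrite mulr2n mulrDl !mul1r expRD expr2.
have expN2 x : expR (- 2 * x) = expR (- x) ^+ 2 :> R.
  by rewrite mulNr -mulrN exp2.
have VE D a b c w : V D a b c w = (if eps t w \in D then 1 else 0) *
    (expR (a * delta t.+1 w) * expR (b * eps t w) * expR (c * eps t.+1 w)).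
  by rewrite /V indicE; case: (_ \in D) => /=; ring.
have inL w : (eps t w \in L) = (eps t w <= - (k * sigma)).
  by rewrite mem_setE in_itv.
have inU w : (eps t w \in U) = (k * sigma <= eps t w).
  by rewrite mem_setE in_itv/= andbT.
have Er : has_expectation P r m.
  (* The terms with exponents (1, 0, 0) have equal expectations on the two tails and cancel, which
     leaves Q(k - sigma) - Q(k + sigma), the mass of the interval. *)
  have := has_expectationZ (expR mu1) (has_expectationD
    (has_expectationD (EL 1 (- 1) 1) (has_expectationZ (- 1) (EL 1 0 0)))
    (has_expectationZ (- 1) (has_expectationD
      (EU 1 (- 1) 1) (has_expectationZ (- 1) (EU 1 0 0))))).
  congr has_expectation.
    apply/funext => w; rewrite rE !VE inL inU !mul1r !mul0r !mulN1r expR0.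
    by case: ifP; case: ifP => _ _; ring.
  rewrite /m stdnormP_itv; last by lra.
  rewrite -/(Q (k - sigma)) -/(Q (k + sigma)) !mulN1r !opprK mul0r addr0 subr0.
  have -> : (1 ^+ 2 * sigma1 ^+ 2 + ((- 1) ^+ 2 + 1 ^+ 2) * sigma ^+ 2) / 2 =
    sigma1 ^+ 2 / 2 + sigma ^+ 2 by field.
  by rewrite !expRD; ring.
have Err : has_expectation P (fun w => r w * r w)
    (expR (mu1 *+ 2 + sigma1 ^+ 2 *+ 2 + sigma ^+ 2 *+ 4) *
         (stdnormP `]-oo, - k + sigma *+ 2] + stdnormP `[k + sigma *+ 2, +oo[)
       - 2 * expR (mu1 *+ 2 + sigma1 ^+ 2 *+ 2 + sigma ^+ 2) *
         (stdnormP `]-oo, - k + sigma] + stdnormP `[k + sigma, +oo[)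
       + 2 * expR (mu1 *+ 2 + sigma1 ^+ 2 *+ 2) * stdnormP `[k, +oo[).
  (* Contribution of one tail to the second moment: the three terms expand (exp(e' - e) - 1)^2 exp(2
     delta). The function [q] is b -> Q(k + b sigma) on [L] and b -> Q(k - b sigma) on [U]. *)
  have E2 (D : set R) (q : R -> R) : (forall a b c, has_expectation P (V D a b c)
      (expR ((a ^+ 2 * sigma1 ^+ 2 + (b ^+ 2 + c ^+ 2) * sigma ^+ 2) / 2) *
       q b)) ->
    has_expectation P
      (fun w => V D 2 (- 2) 2 w + - 2 * V D 2 (- 1) 1 w + V D 2 0 0 w)
      (expR (sigma1 ^+ 2 *+ 2) * (expR (sigma ^+ 2 *+ 4) * q (- 2) -
       2 * expR (sigma ^+ 2) * q (- 1) + q 0)).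
    move=> EV.
    have := has_expectationD (has_expectationD (EV 2 (- 2) 2)
      (has_expectationZ (- 2) (EV 2 (- 1) 1))) (EV 2 0 0).
    congr has_expectation.
    have -> : (2 ^+ 2 * sigma1 ^+ 2 + ((- 2) ^+ 2 + 2 ^+ 2) * sigma ^+ 2) / 2 =
      sigma1 ^+ 2 *+ 2 + sigma ^+ 2 *+ 4 by field.
    have -> : (2 ^+ 2 * sigma1 ^+ 2 + ((- 1) ^+ 2 + 1 ^+ 2) * sigma ^+ 2) / 2 =
      sigma1 ^+ 2 *+ 2 + sigma ^+ 2 by field.
    have -> : (2 ^+ 2 * sigma1 ^+ 2 + (0 ^+ 2 + 0 ^+ 2) * sigma ^+ 2) / 2 =
      sigma1 ^+ 2 *+ 2 by field.
    by rewrite !expRD; ring.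
  have := has_expectationZ (expR (mu1 *+ 2))
    (has_expectationD (E2 _ _ EL) (E2 _ _ EU)).
  congr has_expectation.
    apply/funext => w; rewrite rE !VE inL inU !exp2 !expN2 !mul1r !mul0r !mulN1r.
    rewrite expR0 mulr2n expRD.
    (* As [k * sigma > 0], the tails are disjoint: the squared signal is the sum of the two
       indicators, without cross term. *)
    by case: ifP => [eL|_]; case: ifP => [eU|_]; [exfalso; lra|ring..].
  (* The thresholds are put in the form [k + b * sigma] (after reflection) or [k - b * sigma] with b
     = -2, -1. For b = 0 both tails give Q(k), whence the factor 2 in the last term. *)
  have -> : - k + sigma *+ 2 = - (k + - 2 * sigma) by ring.
  have -> : - k + sigma = - (k + - 1 * sigma) by ring.
  rewrite !stdnormP_lower_tail.
  have -> : k + sigma *+ 2 = k - - 2 * sigma by ring.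
  have -> : k + sigma = k - - 1 * sigma by ring.
  rewrite !mul0r addr0 subr0 !expRD -/(Q _) -/(Q _).
  by rewrite /Q; ring.
split; first exact: Er.2.
by rewrite (has_expectation_variance Er Err).
Qed.
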